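(* Let $\mathcal{T}=(0,\infty)$ or $\mathcal{T}=[0,\infty)$, and let $X=\{X(t),\,t\in\mathcal{T}\}$ be a jointly measurable multifractal process with set of scales $\Lambda$ and set $\mathcal{S}\subset\mathcal{T}$, such that $\overline{q}(X)>0$ and $\Lambda=(0,1]$ or $\Lambda=[1,\infty)$. If $\overline{\Lambda}\subset\mathcal{S}$, where $\overline{\Lambda}:=\{1/\lambda:\lambda\in\Lambda\}$, then $X$ is self-similar.
   Context: All processes are real-valued. $\{\cdot\}\overset{d}{=}\{\cdot\}$ denotes equality of finite dimensional distributions. Every process is assumed not identically null: there is $t\in\mathcal{T}$, $t\neq0$, with $P(X(t)\neq0)>0$. A process $X=\{X(t),\,t\in\mathcal{T}\}$ is multifractal (with sets $\Lambda\subset(0,\infty)$, $\mathcal{S}\subset\mathcal{T}$) if for every $\lambda\in\Lambda$ there exists a family of identically distributed positive random variables $\{M(\lambda,t),\,t\in\mathcal{S}\}$, independent of the process $\{X(t)\}$, such that $\{X(\lambda t)\}_{t\in\mathcal{S}}\overset{d}{=}\{M(\lambda,t)X(t)\}_{t\in\mathcal{S}}$. $\overline{q}(X)=\sup\{q\ge0:\ \mathbb{E}|X(t)|^q<\infty\text{ for all }t\in\mathcal{T}\}$. $X$, defined on a probability space $(\Omega,\mathcal{F},P)$, is jointly measurable if $(t,\omega)\mapsto X(t,\omega)$ is $\mathcal{B}(\mathcal{T})\times\mathcal{F}$-measurable. $X$ is self-similar if for every $a>0$ there exists a deterministic $b>0$ such that $\{X(at)\}\overset{d}{=}\{bX(t)\}$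 over the whole time set.
   Formalization: For T=[0,∞) the claim fails at time 0 if 0∉S (X(0)=1, X(t)=t, Λ=(0,1], S=[1,∞)); what is proved is self-similarity over T∖{0} always, and over all of T if 0∉T, or 0∈S, or X(0)=0 almost surely. *)

(* Defs.v *)
From HB Require Import structures.
From mathcomp Require Import all_boot all_order all_algebra.
From mathcomp Require Import all_classical all_reals all_analysis.

Set Implicit Arguments.
Unset Strict Implicit.
Unset Printing Implicit Defensive.

Import Order.TTheory GRing.Theory Num.Theory.
Import numFieldNormedType.Exports.

Local Open Scope classical_set_scope.
Local Open Scope ring_scope.

(* A process with time set T (a subset of R) is a family of random variables
   indexed by all of R; every notion below looks only at the times in the set
   it is given, so the values at other times are irrelevant. *)

Definition same_law (R : realType) d d1 d2 (E : measurableType d)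
    (O1 : measurableType d1) (O2 : measurableType d2)
    (P1 : probability O1 R) (P2 : probability O2 R)
    (f : O1 -> E) (g : O2 -> E) : Prop :=
  forall A : set E, measurable A -> pushforward P1 f A = pushforward P2 g A.

Definition fdd_eq (R : realType) d1 d2
    (O1 : measurableType d1) (O2 : measurableType d2)
    (P1 : probability O1 R) (P2 : probability O2 R)
    (T : set R) (X : R -> O1 -> R) (Y : R -> O2 -> R) : Prop :=
  forall (n : nat) (t : n.-tuple R), (forall i, T (tnth t i)) ->
    same_law P1 P2
      (fun w => [tuple X (tnth t i) w | i < n])
      (fun w => [tuple Y (tnth t i) w | i < n]).

Definition process_sigma (R : realType) d (O : measurableType d)
    (T : set R) (X : R -> O -> R) : set (set O) :=
  <<s \bigcup_(t in T) preimage_set_system setT (X t) measurable >>.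

Definition independent_processes (R : realType) d (O : measurableType d)
    (P : probability O R)
    (T : set R) (X : R -> O -> R) (S : set R) (Y : R -> O -> R) : Prop :=
  forall A B : set O, process_sigma T X A -> process_sigma S Y B ->
    P (A `&` B) = (P A * P B)%E.

(* The multipliers M live on an extension (O', P', pi) of the probability space
   carrying X, with pi : O' -> O measure preserving; X is read on O' as
   X t \o pi. Taking pi to be the identity gives multipliers on O itself. *)
Definition multifractal (R : realType) d (O : measurableType d)
    (P : probability O R) (T : set R) (X : R -> {RV P >-> R})
    (L S : set R) : Prop :=
  [/\ L `<=` [set` `]0, +oo[], S `<=` T &
   forall l, L l ->
     exists d' (O' : measurableType d') (P' : probability O' R) (pi : O' -> O)
       (M : R -> {RV P' >-> R}),
     [/\ measurable_fun setT pi /\ same_law P' P pi id,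
         forall t, S t -> {ae P', forall w, 0 < M t w},
         forall t u, S t -> S u -> same_law P' P' (M t) (M u),
         independent_processes P' S M T (fun t => X t \o pi) &
         fdd_eq P P' S (fun t => X (l * t))
           (fun t w => M t w * X t (pi w))]].

Definition qbar (R : realType) d (O : measurableType d)
    (P : probability O R) (T : set R) (X : R -> {RV P >-> R}) : \bar R :=
  ereal_sup [set q%:E | q in [set q : R | 0 <= q /\
    forall t, T t -> ('E_P[fun w => (`|X t w| `^ q)%R] < +oo)%E]].

Definition jointly_measurable (R : realType) d (O : measurableType d)
    (P : probability O R) (T : set R) (X : R -> {RV P >-> R}) : Prop :=
  measurable_fun (T `*` [set: O]) (fun z : R * O => X z.1 z.2).

Definition self_similar (R : realType) d (O : measurableType d)
    (P : probability O R) (T : set R) (X : R -> {RV P >-> R}) : Prop :=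
  forall a : R, 0 < a -> exists2 b : R, 0 < b &
    fdd_eq P P T (fun t => X (a * t)) (fun t w => b * X t w).

Definition not_identically_null (R : realType) d (O : measurableType d)
    (P : probability O R) (T : set R) (X : R -> {RV P >-> R}) : Prop :=
  exists t, [/\ T t, t != 0 & (0 < P [set w | X t w != 0%R])%E].

(* Main.v *)
Require Import Defs.
From HB Require Import structures.
From mathcomp Require Import all_boot all_order all_algebra.
From mathcomp Require Import all_classical all_reals all_analysis.
From mathcomp Require Import measurable_realfun ring.

Set Implicit Arguments.
Unset Strict Implicit.
Unset Printing Implicit Defensive.

Import Order.TTheory GRing.Theory Num.Theory.
Import numFieldNormedType.Exports.

Local Open Scope classical_set_scope.
Local Open Scope ring_scope.

(** Write [F t = E|X t|^r] and [G t = E|X t|^(2r)], with [r > 0] so small that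
    both are finite, and let [M] be the multipliers of a scale [l].  At a single
    time the scaling relation and independence give [F (l t) = E M^r * F t] and
    [G (l t) = E M^(2r) * G t] for [t] in [S].  Since [S] contains every [l^-n],
    going down along these times yields
      [F 1 = (E M^r)^n F (l^-n)] and [G 1 = (E M^(2r))^n G (l^-n)].
    Jensen's inequality [F^2 <= G] at [l^-n] then bounds the powers of the ratio
    [E M^(2r) / (E M^r)^2] by [G 1 / (F 1)^2], so the ratio is at most 1: [M^r]
    has variance zero and the multipliers are almost surely a constant [b l]
    ([lee_sqr_ratio], [multiplier_constant]).  That [F 1] does not vanish is
    where the process must not be identically null: a null [X 1] would make
    [X t] null at every [t > 0], because [t] or [1/t] is a scale
    ([multifractal_moment1_neq0]).

    It remains to pass from scales in [L] and times in [S] to all scales and all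
    times ([scaling_extends]).  For [a > 0] and finitely many positive times
    [t_i], a suitable [e] in [L], small or large as the case may be, puts [a e]
    in [L] and all the [t_i / e] in [S]; comparing [X (a e (t_i / e))] with
    [X (e (t_i / e))] gives scaling by [b (a e) / b e].  This factor depends on
    [a] only, since its [r]-th power is [F a / F 1].  The time 0 is invariant
    under division by [e], so it takes part in this argument if it lies in [S];
    if [X 0] is null, it can be added afterwards ([fdd_eq_null_time]). *)

(** * Equality in law *)

Lemma same_law_map (R : realType) d d' d1 d2 (E : measurableType d)
    (E' : measurableType d') (O1 : measurableType d1) (O2 : measurableType d2)
    (P1 : probability O1 R) (P2 : probability O2 R)
    (f : O1 -> E) (g : O2 -> E) (h : E -> E') :
  measurable_fun setT h -> same_law P1 P2 f g ->
  same_law P1 P2 (h \o f) (h \o g).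
Proof.
move=> mh fg A mA; apply: (fg (h @^-1` A)).
by rewrite -[_ @^-1` _]setTI; exact: mh.
Qed.

Lemma same_law_trans (R : realType) d d1 d2 d3 (E : measurableType d)
    (O1 : measurableType d1) (O2 : measurableType d2) (O3 : measurableType d3)
    (P1 : probability O1 R) (P2 : probability O2 R) (P3 : probability O3 R)
    (f : O1 -> E) (g : O2 -> E) (h : O3 -> E) :
  same_law P1 P2 f g -> same_law P2 P3 g h -> same_law P1 P3 f h.
Proof. by move=> fg gh A mA; rewrite fg// gh. Qed.

Lemma same_law_sym (R : realType) d d1 d2 (E : measurableType d)
    (O1 : measurableType d1) (O2 : measurableType d2)
    (P1 : probability O1 R) (P2 : probability O2 R)
    (f : O1 -> E) (g : O2 -> E) :
  same_law P1 P2 f g -> same_law P2 P1 g f.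
Proof. by move=> fg A mA; rewrite fg. Qed.

Lemma ae_eq_same_law (R : realType) d d1 (E : measurableType d)
    (O1 : measurableType d1) (P1 : probability O1 R) (f g : O1 -> E) :
  measurable_fun setT f -> measurable_fun setT g ->
  {ae P1, forall w, f w = g w} -> same_law P1 P1 f g.
Proof.
move=> mf mg fg A mA; rewrite /pushforward.
have mpre (h : O1 -> E) : measurable_fun setT h -> measurable (h @^-1` A).
  by move=> mh; rewrite -[_ @^-1` _]setTI; exact: mh.
have PE (h : O1 -> E) : measurable_fun setT h ->
    P1 (h @^-1` A) = (\int[P1]_w (\1_(h @^-1` A) w)%:E)%E.
  by move=> mh; rewrite integral_indic ?setIT//; exact: mpre.
rewrite !PE//.
apply: ge0_ae_eq_integral => //.
- by apply/measurable_EFinP; apply: measurable_indic; exact: mpre.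
- by apply/measurable_EFinP; apply: measurable_indic; exact: mpre.
- move: fg; apply: filterS => w fgw _.
  by rewrite !indicE /in_mem/= /in_set /preimage/= fgw.
Qed.

Lemma same_law_ge0_integral (R : realType) d d1 d2 (E : measurableType d)
    (O1 : measurableType d1) (O2 : measurableType d2)
    (P1 : probability O1 R) (P2 : probability O2 R)
    (f : O1 -> E) (g : O2 -> E) (h : E -> \bar R) :
  measurable_fun setT f -> measurable_fun setT g -> measurable_fun setT h ->
  (forall x, 0 <= h x)%E -> same_law P1 P2 f g ->
  (\int[P1]_w h (f w) = \int[P2]_w h (g w))%E.
Proof.
move=> mf mg mh h0 fg.
have pushE d0 (O : measurableType d0) (P : probability O R) (k : O -> E)
    (mk : measurable_fun setT k) :
    (\int[pushforward P k]_y h y = \int[P]_w h (k w))%E.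
  by rewrite ge0_integral_pushforward.
rewrite -!pushE//.
pose Mf := isMeasurableFun.Build _ _ _ _ _ mf.
pose Mg := isMeasurableFun.Build _ _ _ _ _ mg.
pose F : {mfun O1 >-> E} := HB.pack f Mf.
pose G : {mfun O2 >-> E} := HB.pack g Mg.
apply: (@eq_measure_integral _ _ _ _ (distribution P2 G) (distribution P1 F)).
by move=> A mA _; exact: fg.
Qed.

(** An almost sure property of a single variable is a property of its law.  Used
    to carry the constancy of the multiplier at time 1 to all other times. *)
Lemma ae_same_law (R : realType) d d1 d2 (E : measurableType d)
    (O1 : measurableType d1) (O2 : measurableType d2)
    (P1 : probability O1 R) (P2 : probability O2 R)
    (f : O1 -> E) (g : O2 -> E) (A : set E) :
  measurable_fun setT f -> measurable_fun setT g -> measurable A ->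
  same_law P1 P2 f g ->
  {ae P1, forall w, A (f w)} -> {ae P2, forall w, A (g w)}.
Proof.
move=> mf mg mA fg.
have mpre d0 (O0 : measurableType d0) (h : O0 -> E) :
    measurable_fun setT h -> measurable (~` [set w | A (h w)]).
  move=> mh; rewrite -[X in measurable X]setTI.
  by apply: (mh _ (~` A)) => //; exact: measurableC.
move=> /(negligibleP P1 (mpre _ _ _ mf)) fA.
apply/negligibleP; first exact: mpre.
by rewrite -fA; symmetry; apply: (fg (~` A)); exact: measurableC.
Qed.

(** * Coordinatewise operations on tuples *)

Lemma measurable_tuple_scale (R : realType) (n : nat) (c : 'I_n -> R) :
  measurable_fun setT
    (fun x : n.-tuple R => [tuple c i * tnth x i | i < n]).
Proof.
apply/measurable_fun_tnthP => i.
rewrite (_ : _ \o _ = fun x : n.-tuple R => c i * tnth x i); last first.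
  by apply: funext => x /=; rewrite tnth_mktuple.
by apply: measurable_funM => //; exact: measurable_tnth.
Qed.

Lemma same_law_tuple_scale (R : realType) d1 d2
    (O1 : measurableType d1) (O2 : measurableType d2)
    (P1 : probability O1 R) (P2 : probability O2 R) (n : nat)
    (c : 'I_n -> R) (Y : 'I_n -> O1 -> R) (Z : 'I_n -> O2 -> R) :
  same_law P1 P2 (fun w => [tuple Y i w | i < n])
    (fun w => [tuple Z i w | i < n]) ->
  same_law P1 P2 (fun w => [tuple c i * Y i w | i < n])
    (fun w => [tuple c i * Z i w | i < n]).
Proof.
have E (O : Type) (V : 'I_n -> O -> R) :
    (fun w => [tuple c i * V i w | i < n]) =
    (fun x : n.-tuple R => [tuple c i * tnth x i | i < n]) \o
    (fun w => [tuple V i w | i < n]).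
  by apply: funext => w /=; apply: eq_mktuple => i; rewrite tnth_mktuple.
rewrite (E _ Y) (E _ Z); apply: same_law_map.
exact: measurable_tuple_scale.
Qed.

Lemma measurable_mktuple (R : realType) d (O : measurableType d) (n : nat)
    (Y : 'I_n -> O -> R) : (forall i, measurable_fun setT (Y i)) ->
  measurable_fun setT (fun w => [tuple Y i w | i < n]).
Proof.
move=> mY; apply/measurable_fun_tnthP => i; rewrite (_ : _ \o _ = Y i)//.
by apply: funext => w /=; rewrite tnth_mktuple.
Qed.

Lemma ae_eq_same_law_mktuple (R : realType) d (O : measurableType d)
    (P : probability O R) (n : nat) (Y Z : 'I_n -> O -> R) :
  (forall i, measurable_fun setT (Y i)) ->
  (forall i, measurable_fun setT (Z i)) ->
  (forall i, {ae P, forall w, Y i w = Z i w}) ->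
  same_law P P (fun w => [tuple Y i w | i < n])
    (fun w => [tuple Z i w | i < n]).
Proof.
move=> mY mZ YZ; apply: ae_eq_same_law; [exact: measurable_mktuple..|].
have : {ae P, forall w, forall i, Y i w = Z i w} by apply: filter_forall.
by apply: filterS => w YZw; apply: eq_mktuple.
Qed.

(** * Absolute moments *)

Definition abs_moment (R : realType) d (O : measurableType d)
    (P : probability O R) (U : O -> R) (r : R) : \bar R :=
  (\int[P]_w (`|U w| `^ r)%:E)%E.

Lemma measurable_abs_powR (R : realType) (r : R) :
  measurable_fun setT (fun x : R => `|x| `^ r).
Proof. by apply: (measurableT_comp (measurable_powR _)). Qed.

Lemma measurable_abs_powR_fun (R : realType) d (O : measurableType d)
    (U : O -> R) (r : R) : measurable_fun setT U ->
  measurable_fun setT (fun w => `|U w| `^ r).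
Proof. by apply: (measurableT_comp (@measurable_abs_powR _ r)). Qed.

Lemma abs_moment_ge0 (R : realType) d (O : measurableType d)
    (P : probability O R) (U : O -> R) (r : R) : (0 <= abs_moment P U r)%E.
Proof. by apply: integral_ge0 => w _; rewrite lee_fin powR_ge0. Qed.

Lemma same_law_abs_moment (R : realType) d1 d2
    (O1 : measurableType d1) (O2 : measurableType d2)
    (P1 : probability O1 R) (P2 : probability O2 R)
    (U : O1 -> R) (V : O2 -> R) (r : R) :
  measurable_fun setT U -> measurable_fun setT V -> same_law P1 P2 U V ->
  abs_moment P1 U r = abs_moment P2 V r.
Proof.
move=> mU mV UV.
apply: (same_law_ge0_integral (h := fun x : R => (`|x| `^ r)%:E) mU mV) => //.
by apply/measurable_EFinP; exact: measurable_abs_powR.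
Qed.

Lemma abs_momentZ (R : realType) d (O : measurableType d)
    (P : probability O R) (U : O -> R) (b r : R) : measurable_fun setT U ->
  abs_moment P (fun w => b * U w) r = ((`|b| `^ r)%:E * abs_moment P U r)%E.
Proof.
move=> mU; rewrite /abs_moment -ge0_integralZl//.
- by apply: eq_integral => w _; rewrite normrM powRM// EFinM.
- by apply/measurable_EFinP; exact: measurable_abs_powR_fun.
Qed.

Lemma abs_moment_eq0 (R : realType) d (O : measurableType d)
    (P : probability O R) (U : O -> R) (r : R) : measurable_fun setT U ->
  abs_moment P U r = 0%E -> {ae P, forall w, U w = 0}.
Proof.
move=> mU U0.
have mUr : measurable_fun setT (fun w => (`|U w| `^ r)%:E).
  by apply/measurable_EFinP; exact: measurable_abs_powR_fun.
have /(ae_eq_integral_abs P measurableT mUr) :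
    (\int[P]_w `|(`|U w| `^ r)%:E| = 0)%E.
  rewrite -[RHS]U0; apply: eq_integral => w _.
  by rewrite gee0_abs// lee_fin powR_ge0.
apply: filterS => w /(_ I)[] /powR_eq0_eq0 /eqP.
by rewrite normr_eq0 => /eqP.
Qed.

(** Independence turns the joint law of the pair into a product measure, and
    Tonelli's theorem splits the integral. *)
Lemma abs_moment_mul (R : realType) d (O : measurableType d)
    (P : probability O R) (U V : O -> R) (r : R) :
  measurable_fun setT U -> measurable_fun setT V ->
  (forall A B, measurable A -> measurable B ->
    P (U @^-1` A `&` V @^-1` B) = (P (U @^-1` A) * P (V @^-1` B))%E) ->
  abs_moment P (fun w => U w * V w) r = (abs_moment P U r * abs_moment P V r)%E.
Proof.
move=> mU mV UV.
pose MU := isMeasurableFun.Build _ _ _ _ _ mU.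
pose MV := isMeasurableFun.Build _ _ _ _ _ mV.
pose U' : {mfun O >-> R} := HB.pack U MU.
pose V' : {mfun O >-> R} := HB.pack V MV.
have mUV : measurable_fun setT (fun w => (U w, V w)).
  exact: measurable_fun_pair.
pose MUV := isMeasurableFun.Build _ _ _ _ _ mUV.
pose UV' : {mfun O >-> (R * R)%type} := HB.pack (fun w => (U w, V w)) MUV.
pose h (z : R * R) : \bar R := ((`|z.1| `^ r)%:E * (`|z.2| `^ r)%:E)%E.
have mh : measurable_fun setT h.
  apply: emeasurable_funM; apply/measurable_EFinP.
  - exact: (measurable_abs_powR_fun _ measurable_fst).
  - exact: (measurable_abs_powR_fun _ measurable_snd).
have h0 z : (0 <= h z)%E by rewrite mule_ge0// lee_fin powR_ge0.
transitivity (\int[distribution P UV']_z h z)%E.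
  rewrite ge0_integral_distribution//; apply: eq_integral => w _.
  by rewrite /h/= normrM powRM// EFinM.
transitivity (\int[(distribution P U' \x distribution P V')%E]_z h z)%E.
  apply: eq_measure_integral => A mA _; symmetry.
  by apply: product_measure_unique => // B C mB mC; exact: UV.
rewrite fubini_tonelli1// /fubini_F /h/=.
have m1 : measurable_fun setT (fun x : R => (`|x| `^ r)%:E).
  by apply/measurable_EFinP; exact: measurable_abs_powR.
have r0 (x : R) : (0 <= (`|x| `^ r)%:E)%E by rewrite lee_fin powR_ge0.
under eq_integral do rewrite ge0_integralZl//.
rewrite ge0_integralZr//; last by apply: integral_ge0.
by rewrite !ge0_integral_distribution.
Qed.

(** Exponents are written [r] and [r * 2] so that the second moment of [|U|^r]
    is again an absolute moment of [U]. *)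
Lemma variance_abs_powR (R : realType) d (O : measurableType d)
    (P : probability O R) (U : O -> R) (r : R) : measurable_fun setT U ->
  (abs_moment P U (r * 2) < +oo)%E ->
  ('V_P[fun w => (`|U w| `^ r)%R] =
    abs_moment P U (r * 2) - (abs_moment P U r) ^+ 2)%E /\
  (abs_moment P U r < +oo)%E.
Proof.
move=> mU Ufin; set Y := fun w => `|U w| `^ r.
have YE w : `|U w| `^ (r * 2) = `|Y w| `^ 2 
  by rewrite powRrM [`|Y w|]ger0_norm// powR_ge0.
have Y2 : Y \in Lfun P 2%:E.
  rewrite inE; apply/andP; split; rewrite inE/=.
    exact: measurable_abs_powR_fun.
  rewrite /finite_norm unlock; apply: poweR_lty.
  rewrite (eq_integral (fun w => (`|U w| `^ (r * 2))%:E))//= => w _.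
  by rewrite YE.
have EY : ('E_P[Y] = abs_moment P U r)%E by rewrite unlock.
split.
  rewrite varianceE// EY; congr (_ - _)%E; rewrite unlock.
  apply: eq_integral => w _; congr _%:E.
  by rewrite YE -[2]/(2%:R) powR_mulrn// real_normK ?num_real.
have Y1 : Y \in Lfun P 1 by apply: Lfun_subset12 => //; exact: fin_num_measure.
by rewrite -EY ltey_eq expectation_fin_num.
Qed.

(** Jensen's inequality, read off from the nonnegativity of the variance. *)
Lemma abs_moment_sqr_le (R : realType) d (O : measurableType d)
    (P : probability O R) (U : O -> R) (r : R) : measurable_fun setT U ->
  ((abs_moment P U r) ^+ 2 <= abs_moment P U (r * 2))%E.
Proof.
move=> mU; have [->|] := eqVneq (abs_moment P U (r * 2)) +oo%E.
  by rewrite leey.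
rewrite -ltey => /(variance_abs_powR mU)[VE fin1].
have := variance_ge0 P (fun w => `|U w| `^ r).
rewrite VE sube_ge0//; apply/orP; left.
by rewrite fin_numX// ge0_fin_numE// abs_moment_ge0.
Qed.

(** Equality in Jensen's inequality: the variance vanishes. *)
Lemma abs_moment_degenerate (R : realType) d (O : measurableType d)
    (P : probability O R) (U : O -> R) (r : R) : measurable_fun setT U ->
  (abs_moment P U (r * 2) <= (abs_moment P U r) ^+ 2)%E ->
  (abs_moment P U r < +oo)%E ->
  {ae P, forall w, `|U w| `^ r = fine (abs_moment P U r)}.
Proof.
move=> mU Ule Ufin.
have Ufin1 : abs_moment P U r \is a fin_num.
  by rewrite ge0_fin_numE// abs_moment_ge0.
have Ufin2 : (abs_moment P U (r * 2) < +oo)%E.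
  by rewrite (le_lt_trans Ule)// ltey_eq fin_numX.
have [VE _] := variance_abs_powR mU Ufin2.
set Y := (fun w => `|U w| `^ r) in VE *.
pose m := fine (abs_moment P U r).
have EY : ('E_P[Y] = abs_moment P U r)%E by rewrite unlock.
have V0 : (\int[P]_w ((Y w - m) ^+ 2)%:E = 0)%E.
  apply/eqP; rewrite eq_le; apply/andP; split; last first.
    by apply: integral_ge0 => w _; rewrite lee_fin sqr_ge0.
  rewrite [leLHS](_ : _ = 'V_P[Y]%E); last first.
    rewrite /variance unlock/= unlock/=; apply: eq_integral => w _.
    by rewrite /m -EY unlock.
  by rewrite VE sube_le0.
have mY : measurable_fun setT (fun w => ((Y w - m) ^+ 2)%:E).
  apply/measurable_EFinP; apply: measurable_funX; apply: measurable_funB => //.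
  exact: measurable_abs_powR_fun.
have /(ae_eq_integral_abs P measurableT mY) :
    (\int[P]_w `|((Y w - m) ^+ 2)%:E| = 0)%E.
  rewrite -[RHS]V0; apply: eq_integral => w _.
  by rewrite gee0_abs// lee_fin sqr_ge0.
apply: filterS => w /(_ I)[] /eqP.
by rewrite sqrf_eq0 subr_eq0 => /eqP.
Qed.

(** * Moment sequences along a geometric progression *)

(** Bernoulli's inequality makes the powers of a number above 1 unbounded. *)
Lemma bounded_expr_le1 (R : realType) (x C : R) :
  0 <= x -> (forall n : nat, x ^+ n <= C) -> x <= 1.
Proof.
move=> x0 xC; rewrite leNgt; apply/negP => x1.
have bern n : 1 + n%:R * (x - 1) <= x ^+ n.
  elim: n => [|n IH]; first by rewrite mul0r addr0 expr0.
  rewrite exprS -natr1; apply: (le_trans _ (ler_wpM2l x0 IH)).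
  rewrite -subr_ge0.
  rewrite (_ : _ - _ = n%:R * (x - 1) ^+ 2).
    by rewrite mulr_ge0// sqr_ge0.
  by ring.
have Cd : 0 <= C / (x - 1).
  by rewrite divr_ge0 ?subr_ge0 ?(ltW x1)// (le_trans ler01)// -(expr0 x).
have := le_trans (bern (Num.truncn (C / (x - 1))).+1) (xC _).
apply/negP; rewrite -ltNge; apply: ltr_pwDl => //.
by rewrite -ler_pdivrMr ?subr_gt0// ltW// truncnS_gt.
Qed.

(** Unrolling the recursions, [f 0 = m1^n f n] and [g 0 = m2^n g n]; then
    [f n ^ 2 <= g n] bounds the powers of [m2 / m1^2] by [g 0 / f 0 ^ 2]. *)
Lemma le_sqr_ratio (R : realType) (f g : nat -> R) (m1 m2 : R) :
  0 < m1 -> 0 <= m2 -> 0 < f 0%N ->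
  (forall n, f n = m1 * f n.+1) -> (forall n, g n = m2 * g n.+1) ->
  (forall n, f n ^+ 2 <= g n) -> m2 <= m1 ^+ 2.
Proof.
move=> m10 m20 f0 fS gS fg.
have fE n : f 0%N = m1 ^+ n * f n.
  by elim: n => [|n ->]; rewrite ?expr0 ?mul1r// fS mulrA -exprSr.
have gE n : g 0%N = m2 ^+ n * g n.
  by elim: n => [|n ->]; rewrite ?expr0 ?mul1r// gS mulrA -exprSr.
have m1sq : 0 < m1 ^+ 2 by rewrite exprn_gt0.
suff : m2 / m1 ^+ 2 <= 1 by rewrite ler_pdivrMr// mul1r.
apply: (@bounded_expr_le1 _ _ (g 0%N / f 0%N ^+ 2)).
  by rewrite divr_ge0// ltW.
move=> n; rewrite expr_div_n ler_pdivrMr ?exprn_gt0// mulrAC.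
rewrite ler_pdivlMr ?exprn_gt0// [f 0%N](fE n) [g 0%N](gE n).
rewrite exprAC.
rewrite [leLHS](_ : _ = m2 ^+ n * (m1 ^+ n) ^+ 2 * f n ^+ 2); last by ring.
rewrite [leRHS]mulrAC ler_wpM2l// mulr_ge0// exprn_ge0//.
by rewrite exprn_ge0// ltW.
Qed.

(** The same for moments, which are extended reals: finiteness and positivity of
    the factors [m1] and [m2] are forced by the recursions themselves. *)
Lemma lee_sqr_ratio (R : realType) (F G : nat -> \bar R) (m1 m2 : \bar R) :
  (0 <= m1)%E -> (0 <= m2)%E -> F 0%N != 0%E ->
  (forall n, 0 <= F n)%E -> (forall n, G n < +oo)%E ->
  (forall n, F n = m1 * F n.+1)%E -> (forall n, G n = m2 * G n.+1)%E ->
  (forall n, (F n) ^+ 2 <= G n)%E -> (m2 <= m1 ^+ 2)%E /\ (0 < m1 < +oo)%E.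
Proof.
move=> m10 m20 F0 Fge0 Gfin FS GS FG.
have Fn0 n : F n != 0%E.
  elim: n => // n; rewrite FS; apply: contra => /eqP ->; by rewrite mule0.
have Fgt n : (0 < F n)%E by rewrite lt0e Fn0 Fge0.
have Ggt n : (0 < G n)%E by apply: lt_le_trans (FG n); rewrite expe_gt0.
have Ffin n : F n \is a fin_num.
  rewrite ge0_fin_numE//; have := le_lt_trans (FG n) (Gfin n).
  by case: (F n) (Fgt n) => [x _ _|_|//]; rewrite ?ltry// expeS expe1 mulyy.
have m1gt : (0 < m1)%E.
  by rewrite lt0e m10 andbT; apply: contra F0 => /eqP m0; rewrite FS m0 mul0e.
have fin_factor (m A B : \bar R) : (0 <= m)%E -> (0 < B)%E -> (A < +oo)%E ->
    A = (m * B)%E -> (m < +oo)%E.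
  case: m => [m|_|]//; rewrite ?ltry// => B0 Afin AE.
  by move: Afin; rewrite AE gt0_mulye.
have m1fin : (m1 < +oo)%E.
  by apply: (fin_factor m1 (F 0%N) (F 1%N)) => //; rewrite -ge0_fin_numE.
have m2fin : (m2 < +oo)%E by apply: (fin_factor m2 (G 0%N) (G 1%N)).
split; last by rewrite m1gt.
have m1f : m1 \is a fin_num by rewrite ge0_fin_numE.
have m2f : m2 \is a fin_num by rewrite ge0_fin_numE.
have Gf n : G n \is a fin_num by rewrite ge0_fin_numE// ltW.
rewrite -(fineK m1f) -(fineK m2f) -EFin_expe lee_fin.
apply: (@le_sqr_ratio _ (fine \o F) (fine \o G)).
- by rewrite fine_gt0// m1gt.
- exact: fine_ge0.
- by rewrite /= fine_gt0// Fgt ltey_eq Ffin.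
- by move=> n /=; rewrite FS fineM.
- by move=> n /=; rewrite GS fineM.
- by move=> n /=; rewrite -lee_fin EFin_expe !fineK.
Qed.

(** * The multipliers of a scale are constant *)

Lemma fdd_eq_marginal (R : realType) d1 d2
    (O1 : measurableType d1) (O2 : measurableType d2)
    (P1 : probability O1 R) (P2 : probability O2 R)
    (T : set R) (X : R -> O1 -> R) (Y : R -> O2 -> R) (t : R) :
  fdd_eq P1 P2 T X Y -> T t -> same_law P1 P2 (X t) (Y t).
Proof.
move=> XY Tt.
have E (O : Type) (Z : R -> O -> R) : Z t = (@tnth 1 R ^~ ord0) \o
    (fun w => [tuple Z (tnth [tuple t] i) w | i < 1]).
  by apply: funext => w /=; rewrite tnth_mktuple tnth0.
rewrite (E _ X) (E _ Y); apply: same_law_map; first exact: measurable_tnth.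
by apply: XY => i; rewrite (ord1 i) tnth0.
Qed.

Lemma process_sigma_preimage (R : realType) d (O : measurableType d)
    (T : set R) (X : R -> O -> R) (t : R) (A : set R) :
  T t -> measurable A -> process_sigma T X (X t @^-1` A).
Proof.
move=> Tt mA; apply: sub_sigma_algebra; exists t => //.
by exists A => //; rewrite setTI.
Qed.

(** This one-time identity is the only consequence of the independence of the
    multipliers and the process that the proof draws on. *)
Lemma multiplier_moment (R : realType) d d' (O : measurableType d)
    (O' : measurableType d') (P : probability O R) (P' : probability O' R)
    (X : R -> {RV P >-> R}) (M : R -> {RV P' >-> R}) (pi : O' -> O)
    (S T : set R) (l t r : R) :
  measurable_fun setT pi -> same_law P' P pi id ->
  independent_processes P' S M T (fun t => X t \o pi) ->
  fdd_eq P P' S (fun t => X (l * t)) (fun t w => M t w * X t (pi w)) ->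
  S t -> T t ->
  abs_moment P (X (l * t)) r = (abs_moment P' (M t) r * abs_moment P (X t) r)%E.
Proof.
move=> mpi lpi indep fdd St Tt.
have mX : measurable_fun setT (X t \o pi) by exact: measurableT_comp.
rewrite (same_law_abs_moment _ _ _ (fdd_eq_marginal fdd St))//; last first.
  exact: measurable_funM.
rewrite (@abs_moment_mul _ _ _ P' (M t) (X t \o pi))//.
  congr (_ * _)%E; apply: same_law_abs_moment => //.
  by have := same_law_map (measurable_funPT (X t)) lpi.
move=> A B mA mB; apply: indep; first exact: process_sigma_preimage.
exact: (process_sigma_preimage (X := fun t => X t \o pi)).
Qed.

(** [lee_sqr_ratio] applied to the moments of order [r] and [2 r] at the times
    [l^-n] gives equality in Jensen's inequality for the multiplier at time 1;
    the others have the same law. *)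
Lemma multiplier_constant (R : realType) d d' (O : measurableType d)
    (O' : measurableType d') (P : probability O R) (P' : probability O' R)
    (X : R -> {RV P >-> R}) (M : R -> {RV P' >-> R}) (pi : O' -> O)
    (S T : set R) (l r : R) :
  measurable_fun setT pi -> same_law P' P pi id ->
  (forall t, S t -> {ae P', forall w, 0 < M t w}) ->
  (forall t u, S t -> S u -> same_law P' P' (M t) (M u)) ->
  independent_processes P' S M T (fun t => X t \o pi) ->
  fdd_eq P P' S (fun t => X (l * t)) (fun t w => M t w * X t (pi w)) ->
  S `<=` T -> l != 0 -> (forall n, S (l ^- n)) -> 0 < r ->
  (forall t, S t -> abs_moment P (X t) (r * 2) < +oo)%E ->
  abs_moment P (X 1) r != 0%E ->
  exists2 b : R, 0 < b & forall t, S t -> {ae P', forall w, M t w = b}.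
Proof.
move=> mpi lpi M0 MM indep fdd ST l0 Sl r0 fin X1.
have S1 : S 1 by have := Sl 0%N; rewrite expr0 invr1.
have momM t r' : S t -> abs_moment P' (M t) r' = abs_moment P' (M 1) r'.
  by move=> St; apply: same_law_abs_moment => //; exact: MM.
have momS r' n : abs_moment P (X (l ^- n)) r' =
    (abs_moment P' (M 1%R) r' * abs_moment P (X (l ^- n.+1)) r')%E.
  have Sn := Sl n.+1.
  rewrite -(momM _ r' Sn).
  rewrite -(multiplier_moment r' mpi lpi indep fdd Sn (ST _ Sn)).
  by rewrite exprS invfM mulVKf.
have [Mle /andP[Mgt Mfin]] : (abs_moment P' (M 1%R) (r * 2) <=
    (abs_moment P' (M 1%R) r) ^+ 2)%E /\ (0 < abs_moment P' (M 1%R) r < +oo)%E.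
  apply: (@lee_sqr_ratio _ (fun n => abs_moment P (X (l ^- n)) r)
    (fun n => abs_moment P (X (l ^- n)) (r * 2))).
  - exact: abs_moment_ge0.
  - exact: abs_moment_ge0.
  - by rewrite expr0 invr1.
  - by move=> n; exact: abs_moment_ge0.
  - by move=> n; exact: fin.
  - exact: momS.
  - exact: momS.
  - by move=> n; apply: abs_moment_sqr_le.
set m := abs_moment P' (M 1) r in Mle Mgt Mfin.
have m0 : 0 < fine m by rewrite fine_gt0// Mgt.
exists (fine m `^ r^-1); first by rewrite powR_gt0.
have M1 : {ae P', forall w, M 1 w = fine m `^ r^-1}.
  have := M0 _ S1; have := @abs_moment_degenerate _ _ _ P' (M 1) r _ Mle Mfin.
  move=> /(_ (measurable_funPT _)); apply: filterS2 => w <- Mw.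
  by rewrite -powRrM mulfV ?gt_eqF// gtr0_norm// powRr1// ltW.
move=> t St.
exact: (ae_same_law (A := [set fine m `^ r^-1]) _ _ _ (MM _ _ S1 St) M1).
Qed.

(** The process lives on [O] and the multipliers on the extension [O']; once the
    latter are constant, the extension can be forgotten. *)
Lemma multiplier_fdd (R : realType) d d' (O : measurableType d)
    (O' : measurableType d') (P : probability O R) (P' : probability O' R)
    (X : R -> {RV P >-> R}) (M : R -> {RV P' >-> R}) (pi : O' -> O)
    (S : set R) (l b : R) :
  measurable_fun setT pi -> same_law P' P pi id ->
  fdd_eq P P' S (fun t => X (l * t)) (fun t w => M t w * X t (pi w)) ->
  (forall t, S t -> {ae P', forall w, M t w = b}) ->
  fdd_eq P P S (fun t => X (l * t)) (fun t w => b * X t w).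
Proof.
move=> mpi lpi fdd Mb n t St.
apply: (same_law_trans (fdd n t St)).
have mXpi i : measurable_fun setT (fun w => X (tnth t i) (pi w)).
  exact: (measurableT_comp (measurable_funPT (X (tnth t i))) mpi).
apply: (@same_law_trans _ _ _ _ _ _ _ _ _ _ P' _ _
    (fun w => [tuple b * X (tnth t i) (pi w) | i < n])).
  apply: ae_eq_same_law_mktuple => i.
  - exact: measurable_funM.
  - exact: measurable_funM.
  - by have := Mb _ (St i); apply: filterS => w ->.
have mbX : measurable_fun setT (fun w => [tuple b * X (tnth t i) w | i < n]).
  by apply: measurable_mktuple => i; exact: measurable_funM.
exact: (same_law_map mbX lpi).
Qed.

Lemma multifractal_scaling (R : realType) d (O : measurableType d)
    (P : probability O R) (T : set R) (X : R -> {RV P >-> R}) (L S : set R)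
    (r : R) :
  multifractal T X L S -> (forall l n, L l -> S (l ^- n)) -> 0 < r ->
  (forall t, S t -> abs_moment P (X t) (r * 2) < +oo)%E ->
  abs_moment P (X 1) r != 0%E ->
  forall l, L l -> exists2 b : R, 0 < b &
    fdd_eq P P S (fun t => X (l * t)) (fun t w => b * X t w).
Proof.
move=> [L0 ST mf] Sl r0 fin X1 l Ll.
have [d' [Q [P' [pi [M [[mpi lpi] M0 MM indep fdd]]]]]] := mf l Ll.
have l0 : l != 0.
  by have := L0 _ Ll; rewrite /= in_itv/= andbT => l0; rewrite gt_eqF.
have [b b0 Mb] := multiplier_constant mpi lpi M0 MM indep fdd ST l0
  (fun n => Sl l n Ll) r0 fin X1.
by exists b => //; exact: (multiplier_fdd mpi lpi fdd Mb).
Qed.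

(** If [X 1] were null, so would be [X t = X (t * 1)] for each scale [t]; and if
    [t^-1] is a scale, then [X 1 = X (t^-1 * t)] has the law of a positive
    multiplier times [X t], which again forces [X t] to be null. *)
Lemma multifractal_moment1_neq0 (R : realType) d (O : measurableType d)
    (P : probability O R) (T : set R) (X : R -> {RV P >-> R}) (L S : set R)
    (r : R) :
  T `<=` [set` `[0, +oo[] -> multifractal T X L S ->
  (forall t, 0 < t -> L t \/ L t^-1) -> [set l^-1 | l in L] `<=` S ->
  not_identically_null T X ->
  abs_moment P (X 1) r != 0%E.
Proof.
move=> T0 [L0 ST mf] Lcover LS [t [Tt t0 Xt]].
have {t0} tgt : 0 < t by have := T0 _ Tt; rewrite /= in_itv/= andbT lt0r t0.
have L1 : L 1 by have [//|] := Lcover _ ltr01; rewrite invr1.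
have S1 : S 1 by apply: LS; exists 1; rewrite ?invr1.
apply/negP => /eqP X10.
suff /(abs_moment_eq0 (measurable_funPT (X t))) Xt0 :
    abs_moment P (X t) r = 0%E.
  move: Xt; rewrite lt0e => /andP[/negP + _]; apply; apply/eqP.
  have -> : [set w | X t w != 0] = ~` [set w | X t w = 0].
    by apply/seteqP; split => w /= /eqP.
  apply/negligibleP; last exact: Xt0.
  rewrite -[Y in measurable Y]setTI.
  apply: (measurable_funPT (X t) measurableT (~` [set 0])).
  exact: measurableC.
have [Lt|Lt] := Lcover _ tgt.
  have [d' [Q [P' [pi [M [[mpi lpi] M0 MM indep fdd]]]]]] := mf _ Lt.
  have := multiplier_moment r mpi lpi indep fdd S1 (ST _ S1).
  by rewrite mulr1 => ->; rewrite X10 mule0.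
have St : S t by apply: LS; exists t^-1 => //; rewrite invrK.
have [d' [Q [P' [pi [M [[mpi lpi] M0 MM indep fdd]]]]]] := mf _ Lt.
have := multiplier_moment r mpi lpi indep fdd St (ST _ St).
have tV : t^-1 * t = 1 by rewrite mulVf ?gt_eqF.
rewrite tV X10 => /esym/eqP; rewrite mule_eq0 => /orP[|/eqP//].
move=> /eqP /(abs_moment_eq0 (measurable_funPT (M t))) Mt0; exfalso.
have /(negligibleP P' _)/= : {ae P', forall w, False}.
  by have := M0 _ St; move: Mt0; apply: filterS2 => w ->; rewrite ltxx.
rewrite (_ : ~` _ = setT); last by apply/seteqP; split => // x _ [].
move=> /(_ measurableT) /eqP; rewrite probability_setT.
by rewrite eqe oner_eq0.
Qed.

(** * From the scales in L to all scales *)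

(** Some scale is small enough, or large enough, with respect to any finitely
    many positive numbers: what the scales below 1 and the scales above 1 have
    in common for the extension to all scales. *)
Definition directed_scales (R : realType) (L : set R) : Prop :=
  forall s : seq R, (forall x, x \in s -> 0 < x) ->
  exists2 e : R, L e & forall x, x \in s -> L (e / x).

Lemma directed_scales_le1 (R : realType) :
  directed_scales [set` `]0 : R, 1]].
Proof.
elim=> [|y s IH] s0; first by exists 1 => //=; rewrite in_itv/= ltr01 lexx.
have [x xs|e] := IH; first by apply: s0; rewrite inE xs orbT.
rewrite /= in_itv/= => /andP[e0 e1] es.
have y0 : 0 < y by apply: s0; rewrite inE eqxx.
exists (Num.min e y); first by rewrite /= in_itv/= lt_min e0 y0/= ge_min e1.
move=> x; rewrite inE => /predU1P[->|xs].
  rewrite /= in_itv/= divr_gt0 ?lt_min ?e0//= ler_pdivrMr// mul1r ge_min lexx.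
  by rewrite orbT.
have x0 : 0 < x by apply: s0; rewrite inE xs orbT.
have := es _ xs; rewrite /= !in_itv/= => /andP[_ ex].
rewrite divr_gt0 ?lt_min ?e0 ?y0//= (le_trans _ ex)//.
by rewrite ler_wpM2r ?invr_ge0 ?(ltW x0)// ge_min lexx.
Qed.

Lemma directed_scales_ge1 (R : realType) :
  directed_scales [set` `[1 : R, +oo[].
Proof.
elim=> [|y s IH] s0; first by exists 1 => //=; rewrite in_itv/= lexx.
have [x xs|e] := IH; first by apply: s0; rewrite inE xs orbT.
rewrite /= in_itv/= andbT => e1 es.
have y0 : 0 < y by apply: s0; rewrite inE eqxx.
exists (Num.max e y); first by rewrite /= in_itv/= andbT le_max e1.
move=> x; rewrite inE => /predU1P[->|xs].
  by rewrite /= in_itv/= andbT ler_pdivlMr// mul1r le_max lexx orbT.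
have x0 : 0 < x by apply: s0; rewrite inE xs orbT.
have := es _ xs; rewrite /= !in_itv/= !andbT => ex.
rewrite (le_trans ex)//.
by rewrite ler_wpM2r ?invr_ge0 ?(ltW x0)// le_max lexx.
Qed.

(** The constant for [a] is [(F a / F 1)^(1/r)] with [F t = E|X t|^r].  It is
    fixed before the finite set of times is, as self-similarity requires,
    although the proof for given times goes through an auxiliary scale [e] that
    depends on them. *)
Lemma scaling_extends (R : realType) d (O : measurableType d)
    (P : probability O R) (X : R -> {RV P >-> R}) (L S : set R) (r : R) :
  0 < r -> directed_scales L -> [set l^-1 | l in L] `<=` S ->
  L `<=` [set` `]0, +oo[] ->
  (forall l, L l -> exists2 b : R, 0 < b &
    fdd_eq P P S (fun t => X (l * t)) (fun t w => b * X t w)) ->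
  abs_moment P (X 1) r \is a fin_num -> abs_moment P (X 1) r != 0%E ->
  forall a, 0 < a -> exists2 c : R, 0 < c &
    forall (n : nat) (t : n.-tuple R),
      (forall i, 0 < tnth t i \/ tnth t i = 0 /\ S 0) ->
      same_law P P (fun w => [tuple X (a * tnth t i) w | i < n])
        (fun w => [tuple c * X (tnth t i) w | i < n]).
Proof.
move=> r0 Ldir LS L0 scale X1fin X1 a a0.
pose c := fine (abs_moment P (X a) r) / fine (abs_moment P (X 1) r).
have ratioE e b1 b2 : L e -> 0 < b1 -> 0 < b2 ->
    fdd_eq P P S (fun t => X (a * e * t)) (fun t w => b1 * X t w) ->
    fdd_eq P P S (fun t => X (e * t)) (fun t w => b2 * X t w) ->
    c `^ r^-1 = b1 / b2.
  move=> Le b10 b20 fdd1 fdd2.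
  have e0 : e != 0.
    by have := L0 _ Le; rewrite /= in_itv/= andbT => e0; rewrite gt_eqF.
  have Se : S e^-1 by apply: LS; exists e.
  have momE l b : fdd_eq P P S (fun t => X (l * t)) (fun t w => b * X t w) ->
      0 < b ->
      abs_moment P (X (l / e)%R) r =
        ((b `^ r)%:E * abs_moment P (X e^-1%R) r)%E.
    move=> fdd b0.
    rewrite (same_law_abs_moment _ _ _ (fdd_eq_marginal fdd Se))//.
      by rewrite abs_momentZ// gtr0_norm.
    exact: measurable_funM.
  have aE : abs_moment P (X a) r = ((b1 `^ r)%:E * abs_moment P (X e^-1%R) r)%E.
    by rewrite -(momE _ _ fdd1 b10) mulfK.
  have oneE : abs_moment P (X 1%R) r =
      ((b2 `^ r)%:E * abs_moment P (X e^-1%R) r)%E.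
    by rewrite -(momE _ _ fdd2 b20) mulfV.
  have b2r : 0 < b2 `^ r by rewrite powR_gt0.
  have Xe0 : abs_moment P (X e^-1%R) r != 0%E.
    by apply: contra X1 => /eqP Xe; rewrite oneE Xe mule0.
  have Xefin : abs_moment P (X e^-1%R) r \is a fin_num.
    rewrite ge0_fin_numE ?abs_moment_ge0// ltey.
    apply/eqP => Xey; move: X1fin; rewrite oneE Xey gt0_muley//.
  have Xef : fine (abs_moment P (X e^-1%R) r) != 0 by rewrite fine_eq0.
  rewrite /c aE oneE !fineM//= -mulf_div divff// mulr1.
  have -> : b1 `^ r = (b1 / b2) `^ r * b2 `^ r.
    by rewrite -powRM ?divr_ge0 ?ltW// divfK ?gt_eqF.
  by rewrite mulfK ?gt_eqF// -powRrM mulfV ?gt_eqF// powRr1// divr_ge0 ?ltW.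
have scale_at e : L e -> L (a * e) -> exists b1 b2, [/\ 0 < b1, 0 < b2,
    c `^ r^-1 = b1 / b2,
    fdd_eq P P S (fun t => X (a * e * t)) (fun t w => b1 * X t w) &
    fdd_eq P P S (fun t => X (e * t)) (fun t w => b2 * X t w)].
  move=> Le Lae; have [b1 b10 fdd1] := scale _ Lae.
  have [b2 b20 fdd2] := scale _ Le.
  by exists b1, b2; split => //; exact: ratioE fdd1 fdd2.
have a'0 : 0 < a^-1 by rewrite invr_gt0.
exists (c `^ r^-1).
  (* positivity involves no times: any [e] in [L] with [a e] in [L] will do *)
  have [|e Le es] := Ldir [:: a^-1]; first by move=> x; rewrite inE => /eqP ->.
  have Lae : L (a * e) by have := es _ (mem_head _ _); rewrite invrK mulrC.
  by have [b1 [b2 [b10 b20 -> _ _]]] := scale_at e Le Lae; rewrite divr_gt0.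
move=> n t tpos.
(* the entry [a^-1] puts [e / a^-1 = a e] in [L]; a null time stays null after
   division by [e] and is dropped here *)
have [|e Le es] := Ldir (a^-1 :: [seq x <- t | 0 < x]).
  by move=> x; rewrite inE => /predU1P[->//|]; rewrite mem_filter => /andP[].
have Lae : L (a * e) by have := es _ (mem_head _ _); rewrite invrK mulrC.
have [b1 [b2 [b10 b20 -> fdd1 fdd2]]] := scale_at e Le Lae.
have e0 : e != 0.
  by have := L0 _ Le; rewrite /= in_itv/= andbT => e0; rewrite gt_eqF.
pose s := [tuple tnth t i / e | i < n].
have sE i : tnth s i = tnth t i / e by rewrite tnth_mktuple.
have Ss i : S (tnth s i).
  rewrite sE; have [ti0|[-> S0]] := tpos i; last by rewrite mul0r.
  apply: LS; exists (e / tnth t i); last by rewrite invf_div.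
  by apply: es; rewrite inE mem_filter ti0 mem_tnth orbT.
have law1 := fdd1 n s Ss; have law2 := fdd2 n s Ss.
have := same_law_tuple_scale (fun=> b1 / b2) law2.
have -> : (fun w => [tuple b1 / b2 * X (e * tnth s i) w | i < n]) =
    (fun w => [tuple b1 / b2 * X (tnth t i) w | i < n]).
  by apply: funext => w; apply: eq_mktuple => i; rewrite sE mulrCA mulfV ?mulr1.
have -> : (fun w => [tuple b1 / b2 * (b2 * X (tnth s i) w) | i < n]) =
    (fun w => [tuple b1 * X (tnth s i) w | i < n]).
  by apply: funext => w; apply: eq_mktuple => i; rewrite mulrA divfK ?gt_eqF.
move=> law2'; apply: same_law_trans (same_law_sym law2').
have -> // : (fun w => [tuple X (a * tnth t i) w | i < n]) =
    (fun w => [tuple X (a * e * tnth s i) w | i < n]).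
apply: funext => w; apply: eq_mktuple => i.
by rewrite sE -mulrA [e * _]mulrCA mulfV ?mulr1.
Qed.

(** The times 0 are replaced by a dummy time [u] and the corresponding
    coordinates multiplied by 0, a measurable map on tuples. *)
Lemma fdd_eq_null_time (R : realType) d (O : measurableType d)
    (P : probability O R) (X : R -> {RV P >-> R}) (U : set R) (a c u : R) :
  U u -> {ae P, forall w, X 0 w = 0} ->
  fdd_eq P P U (fun t => X (a * t)) (fun t w => c * X t w) ->
  fdd_eq P P (U `|` [set 0]) (fun t => X (a * t)) (fun t w => c * X t w).
Proof.
move=> Uu X0 fdd n t Ut.
pose s := [tuple if tnth t i == 0 then u else tnth t i | i < n].
pose k (i : 'I_n) : R := (tnth t i != 0)%:R.
have sE i : tnth s i = if tnth t i == 0 then u else tnth t i.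
  by rewrite tnth_mktuple.
have Us i : U (tnth s i).
  by rewrite sE; case: eqP => // ti0; case: (Ut i).
have law := same_law_tuple_scale k (fdd n s Us).
have XsE i : {ae P, forall w, X (a * tnth t i) w = k i * X (a * tnth s i) w}.
  rewrite /k sE; case: eqP => [->|_] /=.
    by rewrite mulr0; move: X0; apply: filterS => w ->; rewrite mul0r.
  by apply: aeW => w; rewrite mul1r.
have cXsE i : {ae P, forall w, k i * (c * X (tnth s i) w) = c * X (tnth t i) w}.
  rewrite /k sE; case: eqP => [->|_] /=.
    by move: X0; apply: filterS => w ->; rewrite mul0r mulr0.
  by apply: aeW => w; rewrite mul1r.
apply: (same_law_trans _ (same_law_trans law _));
  apply: ae_eq_same_law_mktuple => // i; do ?exact: measurable_funM.
by apply: measurable_funM => //; exact: measurable_funM.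
Qed.

Lemma qbar_gt0_finite_moment (R : realType) d (O : measurableType d)
    (P : probability O R) (T : set R) (X : R -> {RV P >-> R}) :
  (0 < qbar T X)%E -> exists2 q : R, 0 < q &
    forall t, T t -> (abs_moment P (X t) q < +oo)%E.
Proof.
move=> /ereal_sup_gt[_ [q [_ qfin] <-]]; rewrite lte_fin => q0.
by exists q => // t Tt; have := qfin t Tt; rewrite unlock.
Qed.

(* When T = [0, +oo), the hypotheses leave X 0 unconstrained if 0 is not in S
   (X 0 = 1, X t = t, S = [1, +oo), L = (0, 1]), so the time 0 is included in
   the conclusion only if 0 is in S or X 0 = 0 almost surely; if 0 is not in T
   that condition is void. *)
Theorem proposition2p3 (R : realType) (d : measure_display)
    (O : measurableType d) (P : probability O R)
    (T : set R) (X : R -> {RV P >-> R}) (L S : set R)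
    (hT : T = [set` `]0, +oo[] \/ T = [set` `[0, +oo[])
    (hX0 : not_identically_null T X)
    (hmeas : jointly_measurable T X)
    (hmf : multifractal T X L S)
    (hq : (0 < qbar T X)%E)
    (hL : L = [set` `]0, 1]] \/ L = [set` `[1, +oo[])
    (hLS : [set l^-1 | l in L] `<=` S) :
  self_similar (T `\ 0) X /\
  ((T 0 -> S 0 \/ {ae P, forall w, X 0 w = 0}) -> self_similar T X).
Proof.
have Tge0 t : T t -> 0 <= t.
  by case: hT => ->; rewrite /= in_itv/= andbT// => /ltW.
have Tpos t : 0 < t -> T t.
  by move=> t0; case: hT => ->; rewrite /= in_itv/= andbT// ltW.
have Lgt0 : L `<=` [set` `]0, +oo[] by case: hmf.
have ST : S `<=` T by case: hmf.
have Lcover t : 0 < t -> L t \/ L t^-1.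
  move=> t0; have [t1|/ltW t1] := leP t 1; case: hL => ->;
    rewrite /= !in_itv/= ?andbT.
  - by left; rewrite t0.
  - by right; rewrite invf_ge1.
  - by right; rewrite invr_gt0 t0 invf_le1.
  - by left.
have Ldir : directed_scales L.
  case: hL => ->; [exact: directed_scales_le1|exact: directed_scales_ge1].
have Lexp l n : L l -> L (l ^+ n).
  case: hL => ->; rewrite /= !in_itv/= ?andbT; last exact: exprn_ege1.
  by move=> /andP[l0 l1]; rewrite exprn_gt0// exprn_ile1// ltW.
have SL l n : L l -> S (l ^- n).
  move=> Ll; apply: hLS; by exists (l ^+ n) => //; exact: Lexp.
have [q q0 qfin] := qbar_gt0_finite_moment hq.
pose r := q / 2.
have r0 : 0 < r by rewrite divr_gt0.
have r2 : r * 2 = q by rewrite divfK.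
have X1 : abs_moment P (X 1) r != 0%E.
  apply: (multifractal_moment1_neq0 r _ hmf Lcover hLS hX0) => t Tt.
  by rewrite /= in_itv/= andbT Tge0.
have scale := multifractal_scaling hmf SL r0.
have {}scale : forall l, L l -> exists2 b : R, 0 < b &
    fdd_eq P P S (fun t => X (l * t)) (fun t w => b * X t w).
  by apply: scale => // t St; rewrite r2; exact: qfin (ST _ St).
have X1fin : abs_moment P (X 1) r \is a fin_num.
  rewrite ge0_fin_numE ?abs_moment_ge0//.
  have [||//] := @variance_abs_powR _ _ _ P (X 1) r.
    exact: measurable_funPT.
  by rewrite r2; apply: qfin; exact: Tpos.
have ext := scaling_extends r0 Ldir hLS Lgt0 scale X1fin X1.
have pos t : (T `\ 0) t -> 0 < t.
  by move=> [Tt /eqP t0]; rewrite lt0r t0 Tge0.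
have selfpos : self_similar (T `\ 0) X.
  move=> a /ext[c c0 law]; exists c => // n t Tt; apply: law => i.
  by left; exact: pos.
split=> // X0; have [T0|T0] := pselect (T 0); last first.
  have TE : T `\ 0 = T.
    by apply/setDidl/seteqP; split => // t [Tt /= t0]; rewrite t0 in Tt.
  by rewrite -TE.
have [S0|X0null] := X0 T0.
  move=> a /ext[c c0 law]; exists c => // n t Tt; apply: law => i.
  by have := Tge0 _ (Tt i); rewrite le_eqVlt => /predU1P[<-|]; [right|left].
have TE : T = (T `\ 0) `|` [set 0].
  by rewrite setDKU// => _ ->.
move=> a a0; have [c c0 law] := selfpos a a0; exists c => //.
rewrite TE; apply: (fdd_eq_null_time (u := 1)) => //.
by split; [exact: Tpos|apply/eqP; rewrite oner_eq0].
Qed.
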